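(* Let $\mu$ be a partition and let $D\subseteq\{(i,j)\in\mu: i>1\}$. Let $$F_{\mu,D}(x;q)=\sum_{\sigma\colon\mu\to\mathbb Z_+,\ \operatorname{Des}(\sigma)=D}q^{|\operatorname{Inv}(\sigma)|}x^\sigma ,$$ and let $\boldsymbol\nu(\mu,D)=(\nu^{(1)},\dots,\nu^{(k)})$, $k=\mu_1$, be the tuple of ribbons in which $\nu^{(j)}$ has size $\mu'_j$, cell contents $\{1,2,\dots,\mu'_j\}$, and descent set $\operatorname{Des}(\nu^{(j)})=\{i:(i,j)\in D\}$. Then $$F_{\mu,D}(x;q)=G_{\boldsymbol\nu(\mu,D)}(x;q),$$ where $G_{\boldsymbol\nu}(x;q)$ denotes the LLT polynomial indexed by $\boldsymbol\nu$.
   Context: **Fillings.** $\mathbb Z_+=\{1,2,\dots\}$. For a partition $\mu=(\mu_1\ge\dots\ge\mu_l)$ with transpose $\mu'$, its diagram is $\{(i,j)\in\mathbb Z_+\times\mathbb Z_+: j\le\mu_i\}$, identified with $\mu$; $(i,j)$ is the cell in row $i$, column $j$, and rows are numbered from bottom to top (French convention), so $(i+1,j)$ is directly above $(i,j)$. A filling is a function $\sigma\colon\mu\to\mathbb Z_+$, and $x^\sigma=\prod_{u\in\mu}x_{\sigma(u)}$. $\operatorname{Des}(\sigma)$ is the set of cells $u=(i+1,j)\in\mu$ such that $\sigma(u)>\sigma(v)$, where $v=(i,j)$. Two cells attack each other if either they are two distinct cells in the same row, or they have the form $(i+1,k)$ and $(i,j)$ with $j<k$. The reading order is the total order on cells row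 by row, from top to bottom, left to right within each row. $\operatorname{Inv}(\sigma)$ is the set of pairs $\{u,v\}$ of attacking cells with $u$ preceding $v$ in reading order and $\sigma(u)>\sigma(v)$. **LLT polynomials.** A skew diagram is a subset of $\mathbb Z_+\times\mathbb Z_+$ of the form $\lambda\setminus\mu$ for partition diagrams $\mu\subseteq\lambda$ (translates are not identified). The content of a cell $u=(i,j)$ is $c(u)=i-j$. A semistandard tableau of skew shape $\nu$ is a function $T\colon\nu\to\mathbb Z_+$ weakly increasing along rows (left to right) and strictly increasing up columns; $\operatorname{SSYT}(\nu)$ is the set of these. For a tuple of skew diagrams $\boldsymbol\nu=(\nu^{(1)},\dots,\nu^{(k)})$, $\operatorname{SSYT}(\boldsymbol\nu)=\operatorname{SSYT}(\nu^{(1)})\times\dots\times\operatorname{SSYT}(\nu^{(k)})$, and for $T=(T^{(1)},\dots,T^{(k)})$, $x^T=\prod_j\prod_{u\in\nu^{(j)}}x_{T^{(j)}(u)}$. Entries $T^{(i)}(u)>T^{(j)}(v)$ form an inversion if either $i<j$ and $c(u)=c(v)$, or $i>j$ and $c(u)=c(v)+1$; $\operatorname{inv}(T)$ is the number of inversions. The LLT polynomial is $G_{\boldsymbol\nu}(x;q)=\sum_{T\in\operatorname{SSYT}(\boldsymbol\nu)}q^{\operatorname{inv}(T)}x^T$. **Ribbons.** A ribbon is a connected skew diagram containing no $2\times2$ block of cells. Only ribbons positioned so that the lower-right cell has content $1$ are considered; then the contents of the cells are $1,2,\dots,m$, each occurring once, where $m$ is the size. The descent set $\operatorname{Des}(\nu)$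 of a ribbon $\nu$ is the set of contents $c(u)$ of those cells $u=(i,j)\in\nu$ such that the cell $(i-1,j)$ directly below also belongs to $\nu$. Ribbons of size $m$ correspond one-to-one to descent sets contained in $\{2,\dots,m\}$. *)

(* Defs.v *)
From HB Require Import structures.
From mathcomp Require Import all_boot all_order all_algebra.
From mathcomp Require Import finmap multinomials.monalg.
From mathcomp Require Import boolp classical_sets functions cardinality fsbigop.
From mathcomp Require Import zify.

Set Implicit Arguments.
Unset Strict Implicit.
Unset Printing Implicit Defensive.

Import GRing.Theory.
Local Open Scope fset_scope.

(* The positive integers; they serve both as entries and as indices of the
   variables x_1, x_2, ... *)
Definition Zpos : Type := {n : nat | 0 < n}.
HB.instance Definition _ := Countable.on Zpos.

(* Monomials in the variables (x_i)_(i : Zpos), written multiplicatively, and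
   formal power series in these variables with coefficients in Z[q]; a series
   is given by its coefficient function, and 'X : {poly int} plays the role
   of q. *)
Definition monomial : Type := {cmonom Zpos}.
HB.instance Definition _ := ConomialDef.on monomial.

Definition qseries : Type := monomial -> {poly int}.

(* The series \sum_(t in A) q^(stat t) * wt t. The coefficient of m is the sum
   over all t in A of weight m; the set of these t is finite in all the uses
   below (finite_filling_weight and finite_tableaux_weight). *)
Definition gen_series (T : choiceType) (A : set T) (stat : T -> nat)
    (wt : T -> monomial) : qseries :=
  fun m => (\sum_(t \in [set t | A t /\ wt t = m]%classic) ('X^(stat t) : {poly int}))%R.

Lemma finite_of_inj (T : Type) (U : finType) (A : set T) (f : T -> U) :
  {in A &, injective f} -> finite_set A.
Proof. by move=> injf; rewrite -(eq_finite_set (inj_card_eq injf)). Qed.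

Lemma monom_bound (m : monomial) :
  exists N, forall i : Zpos, m i != 0 -> val i < N.+1.
Proof.
exists (\max_(i <- finsupp m) val i) => i mi.
by rewrite ltnS (@leq_bigmax_seq _ _ _ (fun i : Zpos => val i)) // mem_finsupp.
Qed.

(* A cell (i, j) lies in row i and column j, both numbered from 1; rows are
   numbered from bottom to top. *)
Definition cell : Type := (nat * nat)%type.
HB.instance Definition _ := Countable.on cell.

Definition row_of (u : cell) : nat := u.1.
Definition col_of (u : cell) : nat := u.2.
Definition content (u : cell) : int := ((row_of u)%:Z - (col_of u)%:Z)%R.

(* A partition mu_1 >= ... >= mu_l > 0 is the sequence of its parts; mu_i is
   nth 0 mu i.-1. *)
Definition is_partition (mu : seq nat) : bool := sorted geq mu && (0 \notin mu).

(* mu'_j for 0 < j *)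
Definition conj_part (mu : seq nat) (j : nat) : nat := count (leq j) mu.

Definition diagram (mu : seq nat) : {fset cell} :=
  [fset u in [seq ((i, j) : cell) |
     i <- iota 1 (size mu), j <- iota 1 (nth 0 mu i.-1)]].

Lemma mem_diagram mu (u : cell) : (u \in diagram mu) =
  [&& 0 < row_of u, 0 < col_of u & col_of u <= nth 0 mu (row_of u).-1].
Proof.
rewrite inE; case: u => i j; rewrite /row_of /col_of /=.
apply/allpairsPdep/and3P => [[i' [j' [+ + [-> ->]]]]|[i0 j0 jle]].
  by rewrite !mem_iota => /andP[-> _] /andP[-> ?]; split.
exists i, j; rewrite !mem_iota i0 j0 !add1n !ltnS jle; split => //.
case: i i0 jle => // i _ /=; rewrite ltnNge; apply: contraTN => /(nth_default 0) ->.
by rewrite -ltnNge.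
Qed.

Section Fillings.
Variable mu : seq nat.

Definition filling : Type := {ffun diagram mu -> Zpos}.
HB.instance Definition _ := Choice.on filling.

Implicit Types (sigma : filling) (u v : diagram mu).

Definition fil_monom sigma : monomial :=
  \big[mmul/mone]_(u : diagram mu) ucm (sigma u).

Lemma finite_filling_weight (m : monomial) :
  finite_set [set sigma : filling | fil_monom sigma = m]%classic.
Proof.
have [N ltN] := monom_bound m.
have bnd (sigma : filling) u : fil_monom sigma = m -> val (sigma u) < N.+1.
  by move=> smE; apply: ltN; rewrite -smE /fil_monom (bigD1 u) //= cmM cmUU.
pose h (sigma : filling) : {ffun diagram mu -> 'I_N.+1} :=
  [ffun u => inord (val (sigma u))].
apply: (@finite_of_inj _ _ _ h) => s t; rewrite !inE /= => sm tm /ffunP st.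
apply/ffunP => u; apply/val_inj; have := congr1 val (st u).
by rewrite !ffunE /= !inordK ?bnd.
Qed.
Definition Des sigma : {set diagram mu} :=
  [set u | [exists v : diagram mu,
    [&& row_of (val u) == (row_of (val v)).+1, col_of (val u) == col_of (val v)
      & val (sigma v) < val (sigma u)]]].

Definition attack (u v : cell) : bool :=
  let half a b := (row_of a == (row_of b).+1) && (col_of b < col_of a) in
  [|| (row_of u == row_of v) && (u != v), half u v | half v u].

Definition reads_before (u v : cell) : bool :=
  (row_of v < row_of u) || (row_of u == row_of v) && (col_of u < col_of v).

(* An unordered pair {u, v} is represented by the ordered pair (u, v) in which
   u precedes v in reading order. *)
Definition Inv sigma : {set diagram mu * diagram mu} :=
  [set p | [&& attack (val p.1) (val p.2), reads_before (val p.1) (val p.2)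
             & val (sigma p.2) < val (sigma p.1)]].

Definition F_series (D : {set diagram mu}) : qseries :=
  gen_series [set sigma : filling | Des sigma = D]%classic
    (fun sigma => #|Inv sigma|) fil_monom.

End Fillings.

Definition is_skew_diagram (nu : {fset cell}) : Prop :=
  exists la mu, [/\ is_partition la, is_partition mu,
    diagram mu `<=` diagram la & nu = diagram la `\` diagram mu].

Definition is_ssyt (nu : {fset cell}) (T : {ffun nu -> Zpos}) : Prop :=
  (forall u v : nu, row_of (val u) = row_of (val v) ->
     col_of (val u) <= col_of (val v) -> val (T u) <= val (T v)) /\
  (forall u v : nu, col_of (val u) = col_of (val v) ->
     row_of (val u) < row_of (val v) -> val (T u) < val (T v)).

Section LLT.
Variables (k : nat) (nu : 'I_k -> {fset cell}).

Definition tableaux : Type := {dffun forall j : 'I_k, {ffun nu j -> Zpos}}.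
HB.instance Definition _ := Choice.on tableaux.

Implicit Type T : tableaux.

Definition tab_monom T : monomial :=
  \big[mmul/mone]_(j < k) \big[mmul/mone]_(u : nu j) ucm (T j u).

Lemma finite_tableaux_weight (m : monomial) :
  finite_set [set T : tableaux | tab_monom T = m]%classic.
Proof.
have [N ltN] := monom_bound m.
have bnd (T : tableaux) j u : tab_monom T = m -> val (T j u) < N.+1.
  move=> smE; apply: ltN; rewrite -smE /tab_monom (bigD1 j) //= cmM.
  by rewrite (bigD1 u) //= cmM cmUU.
pose h (T : tableaux) :
    {dffun forall j : 'I_k, {ffun nu j -> 'I_N.+1}} :=
  [ffun j => [ffun u => inord (val (T j u))]].
apply: (@finite_of_inj _ _ _ h) => s t; rewrite !inE /= => sm tm /ffunP st.
apply/ffunP => j; apply/ffunP => u; apply/val_inj.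
have := congr1 (fun f : {ffun nu j -> _} => val (f u)) (st j).
by rewrite !ffunE /= !inordK ?bnd.
Qed.
(* Number of inversions T^(i)(u) > T^(j)(v). *)
Definition tab_inv T : nat :=
  \sum_(i < k) \sum_(j < k) #|[set p : nu i * nu j |
    (val (T j p.2) < val (T i p.1)) &&
    ((i < j) && (content (val p.1) == content (val p.2)) ||
     (j < i) && (content (val p.1) == content (val p.2) + 1)%R)]|.

Definition LLT : qseries :=
  gen_series [set T : tableaux | forall j, is_ssyt (T j)]%classic tab_inv tab_monom.

End LLT.

Definition adjacent (u v : cell) : bool :=
  (row_of u == row_of v) &&
    ((col_of u == (col_of v).+1) || (col_of v == (col_of u).+1)) ||
  (col_of u == col_of v) &&
    ((row_of u == (row_of v).+1) || (row_of v == (row_of u).+1)).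

Definition is_ribbon (nu : {fset cell}) : Prop :=
  [/\ is_skew_diagram nu,
      forall u v : nu, connect (fun a b : nu => adjacent (val a) (val b)) u v
    & forall i j, ~ [/\ (i, j) \in nu, (i, j.+1) \in nu,
                        (i.+1, j) \in nu & (i.+1, j.+1) \in nu]].

Definition contents (nu : {fset cell}) : {fset int} := [fset content u | u in nu].

(* Skew diagrams have no cell in row 0, so truncated predecessor is harmless. *)
Definition ribbon_Des (nu : {fset cell}) : {fset int} :=
  [fset content u | u in nu & ((row_of u).-1, col_of u) \in nu].

(* nu is a tuple of ribbons nu(mu, D); the ordinal j : 'I_(mu_1) stands for
   the column j + 1 of mu. Such a tuple is determined only up to diagonal
   translations of its components, which do not affect contents. *)
Definition is_ribbon_tuple (mu : seq nat) (D : {set diagram mu})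
    (nu : 'I_(head 0 mu) -> {fset cell}) : Prop :=
  forall j : 'I_(head 0 mu),
    [/\ is_ribbon (nu j),
        #|` nu j| = conj_part mu j.+1,
        contents (nu j) = [fset i%:Z%R | i in iota 1 (conj_part mu j.+1)]
      & ribbon_Des (nu j) =
          [fset (row_of (val u))%:Z%R | u in D & col_of (val u) == j.+1]].

Lemma order_ideal_diagram (P : {fset cell}) :
  (forall u, u \in P -> 0 < row_of u /\ 0 < col_of u) ->
  (forall u v : cell, u \in P -> 0 < row_of v <= row_of u ->
     0 < col_of v <= col_of u -> v \in P) ->
  exists2 mu, is_partition mu & P = diagram mu.
Proof.
move=> P0 Pdown.
pose f i := \max_(u <- P | i <= row_of u) col_of u.
pose L := \max_(u <- P) row_of u.
have fP i j : 0 < i -> 0 < j -> (j <= f i) = (((i, j) : cell) \in P).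
  move=> i0 j0; apply/idP/idP => [|ijP]; last first.
    by rewrite /f (@leq_bigmax_seq _ _ _ col_of (i, j)).
  apply: contraTT => ijP; rewrite -ltnNge -[j]prednK // ltnS.
  apply/bigmax_leqP_seq => u uP iu; rewrite -ltnS prednK // ltnNge.
  apply: contra ijP => ju; apply: (Pdown u) => //=.
    by rewrite /row_of /= i0.
  by rewrite /col_of /= j0.
have fS i : f i.+1 <= f i.
  apply/bigmax_leqP_seq => u uP iu.
  by rewrite (@leq_bigmax_seq _ _ (fun u => i <= row_of u) col_of) // ltnW.
have fL i : L < i -> f i = 0.
  move=> Li; rewrite /f big_seq_cond big_pred0 // => u.
  apply/negP => /andP[uP iu]; have := leq_trans Li iu.
  by rewrite ltnNge (@leq_bigmax_seq _ _ xpredT row_of).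
have f0 i : i < L -> 0 < f i.+1.
  rewrite ltnNge; apply: contraNT; rewrite -leqNgt leqn0 => /eqP fi0.
  apply/bigmax_leqP_seq => u uP _; rewrite leqNgt; apply/negP => iu.
  have : col_of u <= f i.+1.
    exact: (@leq_bigmax_seq _ _ (fun u => i < row_of u) col_of).
  by rewrite fi0 leqNgt (P0 u uP).2.
exists (mkseq (fun i => f i.+1) L).
  apply/andP; split.
    apply/(sortedP 0) => i; rewrite size_mkseq => iL.
    by rewrite !nth_mkseq ?(ltnW iL) //=.
  apply/negP => /(nthP 0)[i]; rewrite size_mkseq => iL.
  by rewrite nth_mkseq // => fi; have := f0 i iL; rewrite fi.
apply/fsetP => u; rewrite mem_diagram.
apply/idP/and3P => [uP|[]].
  have [u1 u2] := P0 u uP; split=> //.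
  have cf : col_of u <= f (row_of u) by rewrite fP //; case: u uP {u1 u2}.
  have [uL|] := ltnP (row_of u).-1 L; first by rewrite nth_mkseq // prednK.
  move=> Lu; have := fL (row_of u); rewrite -[row_of u]prednK // ltnS Lu prednK //.
  by move=> /(_ isT) fu; move: cf; rewrite fu leqNgt u2.
case: u => i j; rewrite /row_of /col_of /= => i0 j0.
have [uL|Lu] := ltnP i.-1 L; first by rewrite nth_mkseq // prednK // fP.
by rewrite nth_default ?size_mkseq // leqNgt j0.
Qed.

Section RibbonExists.
Variables (m : nat) (d : pred nat).

Let r c := (m.+1 + \sum_(2 <= e < c.+1) d e)%N.
Let p c : cell := (r c, r c - c).
Let nu : {fset cell} := [fset u in [seq p c | c <- iota 1 m]].

Let rS c : 0 < c -> (r c.+1 = r c + d c.+1)%N.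
Proof. by move=> c0; rewrite /r big_nat_recr //= addnA. Qed.

Let r_mono c k : 0 < c -> (r c <= r (c + k) <= r c + k)%N.
Proof.
move=> c0; elim: k => [|k IH]; first by rewrite addn0 addn0 leqnn.
by rewrite addnS rS ?addn_gt0 ?c0 //; case: (d _); lia.
Qed.

Let r_mono' c e : 0 < c -> c <= e -> r c <= r e /\ (r e <= r c + (e - c))%N.
Proof. by move=> c0 ce; have /andP := r_mono (e - c) c0; rewrite subnKC. Qed.

Let r_gt c : m < r c. Proof. by rewrite /r addSn ltnS leq_addr. Qed.

Let nuP (u : cell) : reflect (exists2 c, 0 < c <= m & u = p c) (u \in nu).
Proof.
rewrite inE /=; apply: (iffP mapP) => -[c]; rewrite ?mem_iota => cm ->.
  by exists c => //; lia.
by exists c => //; rewrite mem_iota; lia.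
Qed.

Let content_p c : c <= m -> content (p c) = c%:Z%R.
Proof. by move=> cm; rewrite /content /=; have := r_gt c; lia. Qed.

Let p_inj : {in iota 1 m &, injective p}.
Proof.
move=> c e; rewrite !mem_iota => ? ? /(congr1 content).
by rewrite !content_p; lia.
Qed.

Let skew_nu : is_skew_diagram nu.
Proof.
pose below (u : cell) := has (fun c => (row_of u <= row_of (p c)) &&
  (col_of u <= col_of (p c))) (iota 1 m).
pose P : {fset cell} := [fset u in [seq ((i, j) : cell) |
  i <- iota 1 (r m), j <- iota 1 (r m)] | below u].
have PP (u : cell) : reflect
    [/\ 0 < row_of u, 0 < col_of u & exists c, [/\ 0 < c, c <= m,
         row_of u <= r c & col_of u <= r c - c]] (u \in P).
  rewrite inE; apply: (iffP andP).
    case=> /allpairsPdep[i [j [+ + ->]]]; rewrite !mem_iota => i1 j1.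
    move=> /hasP[c]; rewrite mem_iota => c1 /andP[]; rewrite /row_of /col_of /=.
    by move=> ? ?; split; [lia|lia|exists c; split; lia].
  case=> u1 u2 [c [c1 cm ur uc]]; have [rm _] := r_mono' c1 cm; split.
    by apply/allpairsPdep; exists u.1, u.2; rewrite !mem_iota; split;
      [rewrite -/(row_of u); lia | rewrite -/(col_of u); lia | case: (u)].
  by apply/hasP; exists c; rewrite ?mem_iota ?ur //; lia.
have nu0 u : u \in nu -> u \in P.
  case/nuP => c /andP[c0 cm] ->; apply/PP; rewrite /row_of /col_of /=.
  by have := r_gt c; split; [lia|lia|exists c; split; lia].
have Pdown (u v : cell) : u \in P -> 0 < row_of v <= row_of u ->
    0 < col_of v <= col_of u -> v \in P.
  case/PP => _ _ [c [c0 cm ur uc]] /andP[? ?] /andP[? ?]; apply/PP.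
  by split => //; exists c; split; lia.
have [|la la_part eP] := order_ideal_diagram _ Pdown.
  by move=> u /PP[].
have [||mu mu_part eQ] := @order_ideal_diagram (P `\` nu).
- by move=> u /fsetDP[/PP[]].
- move=> u v /fsetDP[uP uN] vr vc; apply/fsetDP; split; first exact: (Pdown u).
  apply: contra uN => /nuP[c /andP[c0 cm] vE].
  have {uP} /PP[u1 u2 [e [e0 em ur uc]]] := uP.
  rewrite /row_of /col_of in u1 u2 ur uc.
  have cr : r c <= u.1 by move: vr; rewrite vE => /andP[].
  have cc : r c - c <= u.2 by move: vc; rewrite vE => /andP[].
  have := r_gt c; have := r_gt e => re rc.
  have [ce|ec] := leqP c e.
    have [? ?] := r_mono' c0 ce.
    pose x := (c + (u.1 - r c))%N.
    have cx : c <= x by lia.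
    have xe : x <= e by lia.
    have [? ?] := r_mono' c0 cx.
    have [? ?] := r_mono' (leq_trans c0 cx) xe.
    apply/nuP; exists x; first lia.
    by rewrite [u]surjective_pairing; congr pair; lia.
  have [? ?] := r_mono' e0 (ltnW ec).
  pose x := u.1 - u.2.
  have ex : e <= x by lia.
  have xc : x <= c by lia.
  have [? ?] := r_mono' e0 ex.
  have [? ?] := r_mono' (leq_trans e0 ex) xc.
  apply/nuP; exists x; first lia.
  by rewrite [u]surjective_pairing; congr pair; lia.
exists la, mu; split => //; rewrite -eP -eQ; first exact: fsubsetDl.
apply/fsetP => u; rewrite !in_fsetD; have := nu0 u.
by case: (u \in nu) => [->//|_]; case: (u \in P).
Qed.

Let ribbon_nu : is_ribbon nu.
Proof.
split; first exact: skew_nu.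
  pose e := (fun a b : nu => adjacent (val a) (val b)).
  have esym : symmetric e.
    by move=> a b; rewrite /e /adjacent ![row_of (val a) == _]eq_sym
      ![col_of (val a) == _]eq_sym /=; lia.
  have key c : c < m -> forall a b : nu, val a = p c.+1 -> val b = p 1 ->
      connect e a b.
    elim: c => [|c IH] cm a b ac b1.
      by rewrite (_ : a = b) //; apply: val_inj; rewrite ac b1.
    have cnu : p c.+1 \in nu by apply/nuP; exists c.+1 => //; lia.
    apply: connect_trans (IH (ltnW cm) [` cnu] b erefl b1).
    apply: connect1; rewrite /e ac /adjacent /= /row_of /col_of /=.
    by rewrite rS //; have := r_gt c.+1; case: (d _); lia.
  move=> a b.
  have /nuP[ca /andP[ca0 cam] ae] := valP a.
  have /nuP[cb /andP[cb0 cbm] be] := valP b.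
  have nu1 : p 1 \in nu by apply/nuP; exists 1 => //; lia.
  apply: (@connect_trans _ _ [` nu1]); first apply: (key ca.-1); rewrite ?prednK //.
  rewrite (sym_connect_sym esym); apply: (key cb.-1); rewrite ?prednK //.
move=> i j [/nuP[a a0 aE] _ _ /nuP[b b0 bE]].
have : content (i, j) = content (i.+1, j.+1) by rewrite /content /row_of /col_of /=; lia.
rewrite aE bE !content_p; [|lia|lia] => -[ab].
have := congr1 fst aE; have := congr1 fst bE; rewrite ab /=; lia.
Qed.

Lemma ribbon_exists : exists nu : {fset cell}, [/\ is_ribbon nu, #|` nu| = m,
  contents nu = [fset i%:Z%R | i in iota 1 m] &
  ribbon_Des nu = [fset i%:Z%R | i in iota 2 m.-1 & d i]].
Proof.
exists nu; split; first exact: ribbon_nu.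
- rewrite card_fseq undup_id ?size_map ?size_iota //.
  by rewrite map_inj_in_uniq ?iota_uniq.
- apply/fsetP => z; apply/imfsetP/imfsetP => -[/= u].
    case/nuP => c cm -> ->; exists c; rewrite ?mem_iota ?content_p //; lia.
  rewrite mem_iota => um ->; exists (p u); rewrite ?content_p //; last lia.
  by apply/nuP; exists u => //; lia.
apply/fsetP => z; apply/imfsetP/imfsetP => -[/= u].
  rewrite inE => /andP[/nuP[c cm ->] /nuP[e em pe] ->].
  have er : (r c).-1 = r e := congr1 fst pe.
  have ec : r c - c = r e - e := congr1 snd pe.
  exists c; last by rewrite content_p //; lia.
  have := r_gt c; have := r_gt e; move=> re rc.
  have ce : c = e.+1 by lia.
  have e0 : 0 < e by lia.
  rewrite inE mem_iota /= ce; move: er; rewrite ce (rS e0).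
  by case: (d _); lia.
rewrite inE mem_iota => /andP[um du] ->; exists (p u); last by rewrite content_p //; lia.
rewrite inE; apply/andP; split; apply/nuP; first by exists u => //; lia.
exists u.-1; first lia.
have u0 : 0 < u.-1 by lia.
have := r_gt u.-1; have := rS u0; rewrite prednK; last lia.
rewrite du => ru rgt; rewrite /row_of /col_of /p; cbn [fst snd].
by congr pair; lia.
Qed.
End RibbonExists.

Lemma leq_conj_part mu i j : is_partition mu -> 0 < j ->
  j <= nth 0 mu i.-1 -> i <= conj_part mu j.
Proof.
move=> /andP[smu _] j0; elim: mu i smu => [|x mu IH] [|i] //=.
  by rewrite nth_nil leqNgt j0.
rewrite (path_sortedE (rev_trans leq_trans)) => /andP[/allP ax smu].
case: i => [->//|i] /= ji; have := IH i.+1 smu ji; rewrite /conj_part /=.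
suff -> : j <= x by rewrite add1n ltnS.
have [im|] := ltnP i (size mu).
  exact: leq_trans ji (ax _ (mem_nth _ im)).
by move=> /(nth_default 0) im; move: ji; rewrite im leqNgt j0.
Qed.

Lemma ribbon_tuple_exists mu (D : {set diagram mu}) : is_partition mu ->
  D \subset [set u : diagram mu | 1 < row_of (val u)] ->
  exists nu, is_ribbon_tuple D nu.
Proof.
move=> mu_part /fintype.subsetP D1.
suff /choice[nu nuP] : forall j : 'I_(head 0 mu), exists n : {fset cell},
    [/\ is_ribbon n, #|` n| = conj_part mu j.+1,
        contents n = [fset i%:Z%R | i in iota 1 (conj_part mu j.+1)]
      & ribbon_Des n =
          [fset (row_of (val u))%:Z%R | u in D & col_of (val u) == j.+1]].
  by exists nu.
move=> j; have [n [n1 n2 n3 n4]] := ribbon_exists (conj_part mu j.+1)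
  (fun i => [exists u in D, (row_of (val u) == i) && (col_of (val u) == j.+1)]).
exists n; split => //; rewrite n4; apply/fsetP => z.
apply/imfsetP/imfsetP => -[/= u].
  rewrite inE => /andP[_ /existsP[v /and3P[vD /eqP vr vc]]] ->.
  by exists v; rewrite ?inE ?vD // vr.
rewrite inE => /andP[uD uc] ->; exists (row_of (val u)) => //.
rewrite inE; apply/andP; split; last first.
  by apply/existsP; exists u; rewrite uD uc eqxx.
have := D1 u uD; rewrite inE => u1; rewrite mem_iota u1.
have := valP u; rewrite mem_diagram => /and3P[_ u2].
by move/(leq_conj_part mu_part u2); rewrite (eqP uc); lia.
Qed.

(* Main.v *)
(* Reading column j of a filling from bottom to top as the contents 1, 2, ...
   of the j-th ribbon matches fillings with tuples of arbitrary labellings,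
   preserving weights. A pair of attacking cells in one row is a pair of equal
   contents, and one in consecutive rows is a pair of contents differing by 1,
   so inversions agree. Consecutive contents in a ribbon are adjacent cells,
   one above the other at a descent and side by side otherwise; hence being
   semistandard is a condition on consecutive contents only, and it says that
   the descent set of the filling is D. *)

Require Import Defs.
From mathcomp Require Import all_boot all_order all_algebra.
From mathcomp Require Import finmap multinomials.monalg.
From mathcomp Require Import boolp classical_sets fsbigop.
From mathcomp Require Import zify.

Set Implicit Arguments.
Unset Strict Implicit.
Unset Printing Implicit Defensive.

Import GRing.Theory.
Local Open Scope fset_scope.

(** For a cell in row 1 this has row 0, so it lies in no skew diagram. *)
Definition below (u : cell) : cell := ((row_of u).-1, col_of u).

(** * Semistandard fillings of a single ribbon *)

Section Ribbon.
Variables (nu : {fset cell}) (m : nat).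
Hypothesis nuP : [/\ is_ribbon nu, #|` nu| = m
  & contents nu = [fset i%:Z%R | i in iota 1 m]].

Lemma ribbon_content_onto c : 0 < c <= m ->
  exists u : nu, content (val u) = c%:Z%R.
Proof.
move=> cm; have : c%:Z%R \in contents nu.
  by have [_ _ ->] := nuP; apply/imfsetP; exists c; rewrite //= mem_iota; lia.
by case/imfsetP => u /= uN ->; exists [` uN].
Qed.

Lemma ribbon_content_range (u : nu) :
  exists2 c, 0 < c <= m & content (val u) = c%:Z%R.
Proof.
have : content (val u) \in contents nu by apply: in_imfset; apply: valP.
have [_ _ ->] := nuP => /imfsetP[c /=]; rewrite mem_iota => cm ->.
by exists c => //; lia.
Qed.

(** Pigeonhole: the [m] cells attain all [m] contents, so no content repeats. *)
Lemma ribbon_content_inj : injective (fun u : nu => content (val u)).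
Proof.
apply/injectiveP; apply: (@leq_size_uniq _ [seq i%:Z%R | i <- iota 1 m]).
- by rewrite map_inj_uniq ?iota_uniq // => i j; lia.
- move=> _ /mapP[c + ->]; rewrite mem_iota => cm.
  have [|u <-] := @ribbon_content_onto c; first lia.
  exact: codom_f.
- have [_ card_nu _] := nuP.
  by rewrite size_codom size_map size_iota -cardfE card_nu.
Qed.

Lemma ribbon_row_gt0 (u : nu) : 0 < row_of (val u).
Proof.
have [[[la [rho [_ _ _ nuE]]] _ _] _ _] := nuP.
have : val u \in nu by apply: valP.
rewrite [X in _ \in X]nuE => /fsetDP[+ _].
by rewrite mem_diagram => /and3P[].
Qed.

(* Otherwise no edge of the connected graph of cells would leave the nonempty
   set of cells of content at most [content u]. *)
Lemma ribbon_adjacent (u v : nu) :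
  (content (val v) = content (val u) + 1)%R -> adjacent (val u) (val v).
Proof.
move=> uv; apply/negPn/negP => Nadj.
have [[_ conn _] _ _] := nuP.
pose le_u := [pred a : nu | (content (val a) <= content (val u))%R].
have cross (a b : nu) : adjacent (val a) (val b) -> a \in le_u -> b \in le_u.
  rewrite !inE => ab au; apply: contraT => ub.
  (* An edge changes the content by exactly 1, so an edge leaving [le_u] joins the cells of contents
     [content u] and [content u + 1], which are unique. *)
  have au' : a = u.
    apply: ribbon_content_inj; move: ab au ub; rewrite /adjacent /content.
    by lia.
  have bv : b = v.
    apply: ribbon_content_inj; move: ab au ub uv; rewrite /adjacent /content.
    by lia.
  by move: Nadj; rewrite -au' -bv ab.
have adjC (a b : cell) : adjacent a b = adjacent b a.
  by rewrite /adjacent; lia.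
have closed_u : closed (fun a b : nu => adjacent (val a) (val b)) le_u.
  move=> a b ab; apply/idP/idP; first exact: cross.
  by apply: cross; rewrite adjC.
have := closed_connect closed_u (conn u v); rewrite !inE uv.
lia.
Qed.

(** Between adjacent cells the content rises by 1 only upwards or to the left. If the cell below [v]
    is in the ribbon, it has the content of [u], hence is [u]. *)
Lemma ribbon_step (u v : nu) : (content (val v) = content (val u) + 1)%R ->
  if below (val v) \in nu
  then row_of (val v) = (row_of (val u)).+1 /\ col_of (val v) = col_of (val u)
  else row_of (val v) = row_of (val u) /\ col_of (val u) = (col_of (val v)).+1.
Proof.
move=> uv; have adj := ribbon_adjacent uv.
have v0 := ribbon_row_gt0 v.
case: ifP => [bv|].
  suff -> : val u = below (val v).
    by rewrite /below /row_of /col_of /= in v0 *; split=> //; rewrite prednK.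
  suff -> : u = [` bv] by [].
  apply: ribbon_content_inj; move: uv v0.
  by rewrite /below /content /row_of /col_of /=; lia.
move=> /negP Nbv; move: adj uv; rewrite /adjacent /content.
have : ~ (row_of (val v) = (row_of (val u)).+1 /\
    col_of (val v) = col_of (val u)).
  move=> [rv cv]; apply: Nbv; rewrite /below rv cv /=.
  by rewrite -[X in X \in _](surjective_pairing (val u)); apply: valP.
by lia.
Qed.

(** As the content grows the ribbon only climbs or moves left. Hence two cells of one row are joined
    by horizontal steps alone, and two cells of one column by vertical steps alone, so the stepwise
    comparisons chain. *)
Lemma ribbon_path (T : nu -> nat) :
  (forall u v : nu, (content (val v) = content (val u) + 1)%R ->
     (T u < T v) = (below (val v) \in nu)) ->
  forall n (u v : nu), (content (val v) = content (val u) + n%:Z)%R ->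
  [/\ row_of (val u) <= row_of (val v), col_of (val v) <= col_of (val u),
      row_of (val u) = row_of (val v) -> T v <= T u
    & col_of (val u) = col_of (val v) -> 0 < n -> T u < T v].
Proof.
move=> Tstep; elim=> [|n IH] u v uv.
  by rewrite (_ : u = v) //; apply: ribbon_content_inj; rewrite uv addr0.
have [c cm uc] := ribbon_content_range u.
have [d dm vd] := ribbon_content_range v.
have [|w wd] := @ribbon_content_onto d.-1; first by lia.
have wv : (content (val v) = content (val w) + 1)%R by lia.
have uw : (content (val w) = content (val u) + n%:Z)%R by lia.
have [rr cc rT cT] := IH u w uw.
have := ribbon_step wv; have := Tstep w v wv.
case: ifP => _ wvT [rw cw]; split; try lia.
(* The induction hypothesis is strict only for [n > 0]; for [n = 0] the single step from [w] to [v]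
   is the whole path. *)
move=> uv_col _; have [n0|n0] := posnP n.
  suff -> : u = w by [].
  by apply: ribbon_content_inj; rewrite uw n0 addr0.
by apply: ltn_trans (cT _ n0) wvT; rewrite uv_col.
Qed.

Lemma ribbon_ssytP (T : {ffun nu -> Zpos}) :
  is_ssyt T <-> forall u v : nu, (content (val v) = content (val u) + 1)%R ->
    (val (T u) < val (T v)) = (below (val v) \in nu).
Proof.
split=> [[Trow Tcol] u v uv|Tstep].
  have := ribbon_step uv; case: ifP => _ [rv cv].
    by apply: Tcol; rewrite ?cv ?rv.
  by apply/negbTE; rewrite -leqNgt; apply: Trow; rewrite ?rv ?cv.
have path := ribbon_path Tstep.
split=> u v.
  move=> uv_row uv_col.
  (* Contents decrease from left to right, so the path starts at the right-hand cell [v]. *)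
  by have [] := path (col_of (val v) - col_of (val u)) v u;
    rewrite /content; first lia; move=> _ _ /(_ (esym uv_row)).
move=> uv_col uv_row.
by have [] := path (row_of (val v) - row_of (val u)) u v;
  rewrite /content; [lia|move=> _ _ _; apply; lia].
Qed.

End Ribbon.

(** * Attacking pairs in reading order, and columns of a diagram *)

(** With rows read as contents and columns as ribbon indices, the two cases on the right are the two
    kinds of inversion in [tab_inv]. *)
Lemma attack_reads_before (u v : cell) :
  attack u v && reads_before u v =
    (row_of u == row_of v) && (col_of u < col_of v) ||
    (row_of u == (row_of v).+1) && (col_of v < col_of u).
Proof. by rewrite /attack /reads_before; case: (u =P v) => [->|_]; lia. Qed.

Lemma conj_part_leq mu i j : is_partition mu -> 0 < j ->
  0 < i <= conj_part mu j -> j <= nth 0 mu i.-1.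
Proof.
move=> /andP[smu _] j0; elim: mu i smu => [|x mu IH] [|i] //=.
rewrite (path_sortedE (rev_trans leq_trans)) => /andP[/allP ax smu].
case: i => [|i] /=; rewrite /conj_part /=.
  (* The first part is the largest: if it is below [j], no later part can reach [j]. *)
  case: (leqP j x) => //= xj; rewrite add0n -has_count => /hasP[y ymu jy].
  by have := ax y ymu; rewrite /=; lia.
move=> imu; apply: (IH i.+1) => //.
by rewrite /conj_part; case: (leqP j x) imu => /=; lia.
Qed.

Lemma mem_diagram_conj mu i j : is_partition mu -> 0 < j ->
  (((i, j) : cell) \in diagram mu) = (0 < i <= conj_part mu j).
Proof.
move=> mu_part j0; rewrite mem_diagram /row_of /col_of /= j0 /=.
apply/andP/andP => -[i0 ij]; split=> //; first exact: leq_conj_part.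
by apply: conj_part_leq => //; rewrite i0.
Qed.

(** * The bijection between fillings and tuples of labelled ribbons *)

Section Columns.
Variables (mu : seq nat) (D : {set diagram mu}).
Variable nu : 'I_(head 0 mu) -> {fset cell}.
Hypotheses (mu_part : is_partition mu) (nu_tuple : is_ribbon_tuple D nu).

Local Notation tab_cell u := (Tagged (fun j => nu j) u).

Lemma tuple_ribbon j : [/\ is_ribbon (nu j), #|` nu j| = conj_part mu j.+1
  & contents (nu j) = [fset i%:Z%R | i in iota 1 (conj_part mu j.+1)]].
Proof. by have [] := nu_tuple j. Qed.

Lemma tuple_content_range j (u : nu j) :
  exists2 i, 0 < i <= conj_part mu j.+1 & content (val u) = i%:Z%R.
Proof. exact: ribbon_content_range (tuple_ribbon j) u. Qed.

Lemma column_cell_in (p : {j & nu j}) :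
  ((absz (content (val (tagged p))), (tag p).+1) : cell) \in diagram mu.
Proof.
rewrite mem_diagram_conj //.
by have [i i_range ->] := tuple_content_range (tagged p).
Qed.

(** The source is the disjoint union of the ribbons. Taking [absz] loses nothing, since all contents
    are positive. *)
Definition column_cell (p : {j & nu j}) : diagram mu := [` column_cell_in p].

Lemma row_column_cell (p : {j & nu j}) :
  content (val (tagged p)) = (row_of (val (column_cell p)))%:Z%R.
Proof.
by rewrite /row_of /=; have [i _ ->] := tuple_content_range (tagged p).
Qed.

Lemma column_cell_inj : injective column_cell.
Proof.
move=> [j u] [j' v] uv; have := row_column_cell (tab_cell u).
rewrite uv -row_column_cell /=.
have ejj : j = j' by apply/val_inj; have [_ /= []] := congr1 val uv.
case: _ / ejj v {uv} => v uv; congr Tagged.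
exact: (ribbon_content_inj (tuple_ribbon j)).
Qed.

Lemma column_cell_onto (u : diagram mu) : exists p, column_cell p = u.
Proof.
have := valP u; rewrite {1}[val u]surjective_pairing.
have := valP u; rewrite {1}mem_diagram => /and3P[r0 c0 _].
rewrite mem_diagram_conj // => r_range.
(* A nonempty column of [mu] meets row 1, whose length is the number of ribbons. *)
have cj : (col_of (val u)).-1 < head 0 mu.
  rewrite prednK // -nth0; apply: (@conj_part_leq mu 1) => //=.
  by case/andP: r_range; apply: leq_trans.
have [|v vE] := @ribbon_content_onto _ _ (tuple_ribbon (Ordinal cj))
  (row_of (val u)).
  by rewrite /= prednK.
exists (tab_cell v); apply: val_inj; rewrite /= vE /= prednK //.
by rewrite [RHS]surjective_pairing.
Qed.

Lemma column_cell_bij : bijective column_cell.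
Proof.
have [psi psiK] := choice column_cell_onto.
by exists psi => //; apply: inj_can_sym psiK column_cell_inj.
Qed.

Definition filling_tableaux (sigma : filling mu) : tableaux nu :=
  [ffun j => [ffun u => sigma (column_cell (tab_cell u))]].

Lemma filling_tableauxE sigma (p : {j & nu j}) :
  filling_tableaux sigma (tag p) (tagged p) = sigma (column_cell p).
Proof. by rewrite !ffunE; case: p. Qed.

Lemma filling_tableaux_bij : bijective filling_tableaux.
Proof.
have [psi phiK psiK] := column_cell_bij.
exists (fun T : tableaux nu => [ffun u => T (tag (psi u)) (tagged (psi u))]).
  by move=> sigma; apply/ffunP => u; rewrite ffunE filling_tableauxE psiK.
move=> T; apply/ffunP => j; apply/ffunP => u.
by rewrite (filling_tableauxE _ (tab_cell u)) ffunE phiK.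
Qed.

Lemma tab_monom_filling sigma :
  tab_monom (filling_tableaux sigma) = fil_monom sigma.
Proof.
rewrite /tab_monom /fil_monom sig_big_dep (reindex column_cell) /=.
  by apply: eq_bigr => p _; rewrite filling_tableauxE.
exact: onW_bij column_cell_bij.
Qed.

(** Both sides become double sums of indicators over pairs of cells, and reindexing along
    [column_cell] matches them term by term. *)
Lemma tab_inv_filling sigma :
  tab_inv (filling_tableaux sigma) = #|Defs.Inv sigma|.
Proof.
pose inv_pair (p q : {j & nu j}) : bool :=
  (val (sigma (column_cell q)) < val (sigma (column_cell p))) &&
  ((tag p < tag q) && (content (val (tagged p)) == content (val (tagged q))) ||
   (tag q < tag p) &&
     (content (val (tagged p)) == content (val (tagged q)) + 1)%R).
transitivity (\sum_p \sum_q inv_pair p q)%N.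
  rewrite /tab_inv.
  transitivity (\sum_(i < head 0 mu) \sum_(j < head 0 mu)
      \sum_(u : nu i) \sum_(v : nu j)
        inv_pair (tab_cell u) (tab_cell v))%N.
    apply: eq_bigr => i _; apply: eq_bigr => j _.
    rewrite -sum1dep_card big_mkcond pair_bigA; apply: eq_bigr => -[u v] _.
    by rewrite /inv_pair !ffunE /=; case: ifP.
  (* Moving the sum over [u] next to the one over [i] lets each index-cell pair merge into one sum
     over [{j & nu j}]. *)
  under [LHS]eq_bigr do rewrite exchange_big.
  rewrite sig_big_dep; apply: eq_bigr => p _ /=.
  by rewrite sig_big_dep; apply: eq_bigr => q _ /=; case: p q => [i u] [j v].
transitivity (\sum_u \sum_v ((u, v) \in Defs.Inv sigma))%N.
  rewrite (reindex column_cell (onW_bij _ column_cell_bij)) /=.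
  apply: eq_bigr => p _.
  rewrite (reindex column_cell (onW_bij _ column_cell_bij)) /=.
  apply: eq_bigr => q _; congr nat_of_bool.
  rewrite inE andbA attack_reads_before /inv_pair !row_column_cell andbC.
  by rewrite /col_of /=; congr andb; lia.
rewrite pair_bigA -sum1_card [RHS]big_mkcond /=.
by apply: eq_bigr => -[u v] _; case: ifP.
Qed.

(** [ribbon_Des] records only contents; since these determine the cells of a ribbon, membership can
    be tested on the cell itself. *)
Lemma column_cell_in_D (p : {j & nu j}) :
  (column_cell p \in D) = (below (val (tagged p)) \in nu (tag p)).
Proof.
case: p => j u /=; have [_ _ _ desj] := nu_tuple j.
have <- : (content (val u) \in ribbon_Des (nu j)) = (below (val u) \in nu j).
  apply/imfsetP/idP => [[v /= ]|bu].
    rewrite !inE /= => /andP[vN bv] uv.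
    suff -> : u = [` vN] by [].
    exact: (ribbon_content_inj (tuple_ribbon j)).
  by exists (val u) => //; rewrite !inE bu andbT; apply: valP.
rewrite desj (row_column_cell (tab_cell u)); apply/idP/imfsetP => [pD|[v /=]].
  by exists (column_cell (tab_cell u)); rewrite //= !inE pD /=.
rewrite !inE => /andP[vD /eqP v_col] [v_row].
suff -> : column_cell (tab_cell u) = v by [].
apply: val_inj; rewrite [LHS]surjective_pairing [RHS]surjective_pairing.
by congr pair => //; rewrite v_row.
Qed.

Lemma filling_tableaux_ssyt sigma :
  Des sigma = D <-> forall j, is_ssyt (filling_tableaux sigma j).
Proof.
have DesE j (u v : nu j) : (content (val v) = content (val u) + 1)%R ->
    (column_cell (tab_cell v) \in Des sigma) =
    (val (filling_tableaux sigma j u) < val (filling_tableaux sigma j v)).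
  move=> uv; have uv_row : row_of (val (column_cell (tab_cell v))) =
      (row_of (val (column_cell (tab_cell u)))).+1.
    by have := uv; rewrite (row_column_cell (tab_cell u))
      (row_column_cell (tab_cell v)); lia.
  rewrite inE (filling_tableauxE _ (tab_cell u)).
  rewrite (filling_tableauxE _ (tab_cell v)).
  apply/existsP/idP => [[w /and3P[/eqP w_row /eqP w_col]]|uv_lt].
    suff -> : w = column_cell (tab_cell u) by [].
    apply: val_inj; rewrite [LHS]surjective_pairing [RHS]surjective_pairing.
    congr pair; first by move: w_row; rewrite uv_row => -[].
    by rewrite -[LHS]/(col_of (val w)) -w_col.
  by exists (column_cell (tab_cell u)); rewrite uv_row !eqxx.
split=> [sigmaD j|sigma_ss].
  apply/(ribbon_ssytP (tuple_ribbon j)) => u v uv.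
  by rewrite -(DesE _ _ _ uv) sigmaD column_cell_in_D.
apply/setP => x; have [[j v] <-] := column_cell_onto x.
rewrite column_cell_in_D /=.
have [i i_range vi] := tuple_content_range v.
(* Content 1 has no predecessor to compare with. Both sides are then false: a descent would need a
   cell in row 0 of [mu], and a cell below [v] would have content 0. *)
have [i1|i1] := eqVneq i 1.
  apply/idP/idP => [|bv].
    rewrite inE => /existsP[w /and3P[/eqP w_row _ _]].
    have := row_column_cell (tab_cell v); rewrite w_row vi i1.
    by have := valP w; rewrite mem_diagram => /and3P[+ _ _] [w0]; rewrite -w0.
  have := ribbon_row_gt0 (tuple_ribbon j) v; move: vi.
  have [i' i'_range] := tuple_content_range [` bv].
  by rewrite /content /below /row_of /col_of /=; lia.
have [|u ui] := @ribbon_content_onto _ _ (tuple_ribbon j) i.-1; first lia.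
have uv : (content (val v) = content (val u) + 1)%R by rewrite vi ui; lia.
rewrite (DesE _ _ _ uv).
exact: (ribbon_ssytP (tuple_ribbon j) _).1 (sigma_ss j) _ _ uv.
Qed.

End Columns.

Theorem proposition3p4 (mu : seq nat) (hmu : is_partition mu)
    (D : {set diagram mu})
    (hD : D \subset [set u : diagram mu | 1 < row_of (val u)])
    (nu : 'I_(head 0 mu) -> {fset cell}) (hnu : is_ribbon_tuple D nu) :
  F_series D = LLT nu.
Proof.
apply/funext => w; rewrite /F_series /LLT /gen_series.
have [fill tabK fillK] := filling_tableaux_bij hmu hnu.
(* The coefficients of each monomial [w] are compared; it remains that [filling_tableaux] maps the
   fillings of weight [w] with descent set [D] bijectively onto the semistandard tuples of weight
   [w]. *)
rewrite (reindex_fsbig (filling_tableaux hmu hnu)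
  [set sigma : filling mu | Des sigma = D /\ fil_monom sigma = w]%classic).
  by apply: eq_fsbigr => sigma _; rewrite tab_inv_filling.
split=> [sigma [/(filling_tableaux_ssyt hmu hnu)]|sigma tau _ _|T [Tss Tw]].
- by move=> sigma_ss sigma_w; split; rewrite // tab_monom_filling.
- exact: (can_inj tabK).
exists (fill T); last exact: fillK.
split; last by rewrite -(tab_monom_filling hmu hnu) fillK.
by apply/(filling_tableaux_ssyt hmu hnu) => j; rewrite fillK.
Qed.
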